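(* The partial-dual polynomial, regarded as the function $D\mapsto {}^{\partial}\varepsilon_{R(D)}(z)\in\mathbb{Z}[z]$ on framed chord diagrams, satisfies the four-term relations; that is, it is a framed weight system. Explicitly, write $P(D)={}^{\partial}\varepsilon_{R(D)}(z)$, and let $D^{s}_{i,-}$, $D^{s}_{i,+}$ ($i\in\{1,2\}$, $s\in\mathbb{Z}/2\mathbb{Z}$) be the framed chord diagrams on one circle described in the context, built from an oriented core circle, a chord $B$ with endpoints $b_1,b_2$, a fixed endpoint $y$ of a further chord $A$, and an arbitrary finite collection of other framed chords. Then for every choice of these data: $(T_1)$ if $B$ has framing $0$, then $P(D^{0}_{1,-})-P(D^{0}_{1,+})=P(D^{0}_{2,+})-P(D^{0}_{2,-})$; $(T_2)$ if $B$ has framing $0$, then $P(D^{1}_{1,-})-P(D^{1}_{1,+})=P(D^{1}_{2,+})-P(D^{1}_{2,-})$; $(T_3)$ if $B$ has framing $1$, then $P(D^{0}_{1,-})-P(D^{0}_{1,+})=P(D^{1}_{2,-})-P(D^{1}_{2,+})$.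
   Context: **Framed chord diagrams.** A chord diagram is a cubic graph consisting of a selected oriented Hamiltonian cycle (the core circle) and finitely many non-oriented edges (chords) connecting pairs of points on the core circle; all endpoints of chords are distinct points of the circle. It is framed if each chord is assigned a framing in $\mathbb{Z}/2\mathbb{Z}$ ($0$: orientable chord, $1$: disorienting or twisted chord). Framed chord diagrams are considered up to graph isomorphisms that carry core circle to core circle and preserve its orientation and the framings. **Data for the four-term relations.** Fix an oriented core circle, a framed chord $B$ with endpoints $b_1,b_2$, a finite set (possibly empty) of other framed chords, and one more point $y$ on the circle; all these endpoints and $y$ are pairwise distinct. For $i\in\{1,2\}$ and $s\in\mathbb{Z}/2\mathbb{Z}$, let $D^{s}_{i,-}$ (respectively $D^{s}_{i,+}$) be the framed chord diagram obtained by adding a chord $A$ of framing $s$ joining $y$ to a new point $x$ placed immediately before (respectively immediately after) $b_i$ in the direction of the orientation of the circle. Here ''immediately'' means that no chord endpoint, including $y$, lies between $x$ and $b_i$. The four-term relations for framed chord diagrams are the relations $(T_1)$, $(T_2)$, $(T_3)$ of the claim (with $P$ removed), for all such data. A function on framed chord diagrams with values in an abelian group, extended linearly to the free $\mathbb{Z}$-module generated by framed chord diagrams, is a framed weight system if it satisfies all four-term relations, i.e. if it descends to the quotient of this free module by these relations. **Ribbon graphs.** A ribbon graph $G$ is a (possibly non-orientable) surface with boundary represented as the union of two sets of topological discs, a set $V(G)$ of vertices and a set $E(G)$ of edges, such that: vertices and edges intersect in disjoint line segments; each such segment lies on the boundary of precisely one vertex and precisely one edge; every edge contains exactly two such segments.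 **The ribbon graph of a framed chord diagram.** For a framed chord diagram $D$ on one circle, $R(D)$ is the ribbon graph with a single vertex, obtained by attaching a disc to the core circle of $D$ and thickening each chord to a band attached to this disc along small boundary arcs around the two endpoints of the chord. A chord of framing $0$ becomes a regular (untwisted) band, so that the disc together with this band is an annulus. A chord of framing $1$ becomes a half-twisted band, so that the disc together with this band is a Möbius band. The edges of $R(D)$ correspond to the chords of $D$. **Euler genus.** For a connected ribbon graph $G$, let $\gamma(G)$ be its genus as a punctured surface, i.e. the (orientable or non-orientable) genus of the closed surface obtained by capping off all boundary components of $G$ with discs. The Euler genus is $\varepsilon(G)=2\gamma(G)$ if $G$ is orientable and $\varepsilon(G)=\gamma(G)$ if $G$ is non-orientable. (All ribbon graphs $R(D)$ for $D$ on one circle, and all their partial duals, are connected.) **Partial dual.** For a ribbon graph $G$ and $A\subseteq E(G)$, the partial dual $G^{A}$ is the ribbon graph obtained from $G$ by gluing a disc to $G$ along each boundary component of the spanning ribbon subgraph $(V(G),A)$ (these discs are the vertex-discs of $G^{A}$), removing the interiors of all vertex-discs of $G$, and keeping the edge-ribbons unchanged. **Partial-dual polynomial.** For a ribbon graph $G$, $${}^{\partial}\varepsilon_{G}(z)=\sum_{A\subseteq E(G)}z^{\varepsilon(G^{A})}.$$ The partial-dual polynomial of a framed chord diagram $D$ is ${}^{\partial}\varepsilon_{R(D)}(z)$. *)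

(* Defs.v *)
From HB Require Import structures.
From mathcomp Require Import all_boot all_order all_algebra.
Set Implicit Arguments.
Unset Strict Implicit.
Unset Printing Implicit Defensive.
Import GRing.Theory.
Local Open Scope ring_scope.

(* A finite set of points on an oriented circle, up to orientation-preserving
   homeomorphism: [next] sends a point to the following one. *)
Record circle := Circle {
  point :> finType;
  next : point -> point;
  next_cyclic : forall p q : point, fconnect next p q
}.

Lemma next_inj (C : circle) : injective (@next C).
Proof.
have surj (q : C) : q \in codom (@next C).
  case/connectP: (next_cyclic (next q) q) => s + ->.
  elim/last_ind: s => [|s z _] /=; first by rewrite codom_f.
  by rewrite rcons_path last_rcons => /andP[_ /eqP <-]; rewrite codom_f.
apply/injectiveP; rewrite /dinjectiveb -/(codom _).
apply/card_uniqP; rewrite size_codom.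
by apply: eq_card => q; rewrite surj.
Qed.

Definition next_after (C : circle) (b : C) (o : option C) : option C :=
  match o with
  | None => Some (next b)
  | Some p => if p == b then None else Some (next p)
  end.

Definition next_before (C : circle) (b : C) (o : option C) : option C :=
  match o with
  | None => Some b
  | Some p => if next p == b then None else Some (next p)
  end.

Lemma next_after_cyclic (C : circle) (b : C) (o o' : option C) :
  fconnect (next_after b) o o'.
Proof.
have step (p : C) : fconnect (next_after b) (Some p) (Some (next p)).
  have [->|pb] := eqVneq p b.
    apply: (connect_trans (y := None)); apply: connect1; rewrite /= ?eqxx //.
  by apply: connect1; rewrite /= (negPf pb).
have SS (p q : C) : fconnect (next_after b) (Some p) (Some q).
  case/connectP: (next_cyclic p q) => s + ->.
  elim: s p => [|z s IH] p //= /andP[/eqP <- /IH]; exact: connect_trans.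
have SN (p : C) : fconnect (next_after b) (Some p) None.
  by apply: connect_trans (SS p b) (connect1 _); rewrite /= eqxx.
have NS (q : C) : fconnect (next_after b) None (Some q).
  by apply: connect_trans (connect1 _) (SS (next b) q); rewrite /= eqxx.
by case: o o' => [p|] [q|].
Qed.

Lemma next_before_cyclic (C : circle) (b : C) (o o' : option C) :
  fconnect (next_before b) o o'.
Proof.
have [a <-] : exists a : C, next a = b.
  by exists (finv (@next C) b); rewrite (f_finv (@next_inj C)).
rewrite (@eq_fconnect _ _ (next_after a)) ?next_after_cyclic //.
by case=> [p|] //=; rewrite (inj_eq (@next_inj C)).
Qed.

(* One more point, [None], placed immediately after (before) [b]. *)
Definition insert_after (C : circle) (b : C) : circle :=
  @Circle (option C) (next_after b) (next_after_cyclic b).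

Definition insert_before (C : circle) (b : C) : circle :=
  @Circle (option C) (next_before b) (next_before_cyclic b).

(* [mate] exchanges the two endpoints of each chord; [framing p] is the framing
   of the chord ending at [p]: [false] for 0 (orientable), [true] for 1
   (disorienting). *)
Record framed_chord_diagram := FramedChordDiagram {
  core : circle;
  mate : core -> core;
  framing : core -> bool;
  mateK : involutive mate;
  mate_neq : forall p, mate p != p;
  framing_mate : forall p, framing (mate p) = framing p
}.

Definition diagram_iso (D D' : framed_chord_diagram) : Prop :=
  exists h : core D -> core D',
    [/\ bijective h,
        forall p, h (next p) = next (h p),
        forall p, h (mate p) = mate (h p) &
        forall p, framing (h p) = framing p].

(* The data for the four-term relations: the marked points of [fcore] are the
   endpoints of all chords other than A, and [fy]. The value of [fframing] at
   [fy] is irrelevant. *)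
Record four_term_data := FourTermData {
  fcore : circle;
  fy : fcore;
  fmate : fcore -> fcore;
  fframing : fcore -> bool;
  fmateK : involutive fmate;
  fmate_fix : forall p, (fmate p == p) = (p == fy);
  fframing_mate : forall p, fframing (fmate p) = fframing p;
  fb1 : fcore;
  fb1_neq : fb1 != fy
}.

Definition fb2 (X : four_term_data) : fcore X := fmate (fb1 X).

Definition framing_B (X : four_term_data) : bool := fframing (fb1 X).

(* The chord A of framing [s] joins [fy] to the new point [None]. *)
Definition add_mate (X : four_term_data) (o : option (fcore X)) :
    option (fcore X) :=
  match o with
  | None => Some (fy X)
  | Some p => if p == fy X then None else Some (fmate p)
  end.

Definition add_framing (X : four_term_data) (s : bool)
    (o : option (fcore X)) : bool :=
  match o with
  | None => s
  | Some p => if p == fy X then s else fframing p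
  end.

Lemma fmate_eq_y (X : four_term_data) (p : fcore X) :
  (fmate p == fy X) = (p == fy X).
Proof. by rewrite -fmate_fix fmateK eq_sym fmate_fix. Qed.

Lemma add_mateK (X : four_term_data) : involutive (@add_mate X).
Proof.
case=> [p|] /=; last by rewrite eqxx.
by have [->|py] := eqVneq p (fy X); rewrite //= fmate_eq_y (negPf py) fmateK.
Qed.

Lemma add_mate_neq (X : four_term_data) (o : option (fcore X)) :
  add_mate o != o.
Proof.
case: o => [p|] //=; have [//|py] := eqVneq p (fy X).
by rewrite (inj_eq Some_inj) fmate_fix.
Qed.

Lemma add_framing_mate (X : four_term_data) (s : bool)
  (o : option (fcore X)) : add_framing s (add_mate o) = add_framing s o.
Proof.
case: o => [p|] /=; last by rewrite eqxx.
have [//|py] := eqVneq p (fy X).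
by rewrite /= fmate_eq_y (negPf py) fframing_mate.
Qed.

Definition diagram_before (X : four_term_data) (s : bool) (b : fcore X) :
    framed_chord_diagram :=
  @FramedChordDiagram (insert_before b) (@add_mate X) (@add_framing X s)
    (@add_mateK X) (@add_mate_neq X) (@add_framing_mate X s).

Definition diagram_after (X : four_term_data) (s : bool) (b : fcore X) :
    framed_chord_diagram :=
  @FramedChordDiagram (insert_after b) (@add_mate X) (@add_framing X s)
    (@add_mateK X) (@add_mate_neq X) (@add_framing_mate X s).

Definition four_term_1 (V : zmodType) (f : framed_chord_diagram -> V)
    (X : four_term_data) : Prop :=
  framing_B X = false ->
  f (diagram_before false (fb1 X)) - f (diagram_after false (fb1 X)) =
  f (diagram_after false (fb2 X)) - f (diagram_before false (fb2 X)).

Definition four_term_2 (V : zmodType) (f : framed_chord_diagram -> V)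
    (X : four_term_data) : Prop :=
  framing_B X = false ->
  f (diagram_before true (fb1 X)) - f (diagram_after true (fb1 X)) =
  f (diagram_after true (fb2 X)) - f (diagram_before true (fb2 X)).

Definition four_term_3 (V : zmodType) (f : framed_chord_diagram -> V)
    (X : four_term_data) : Prop :=
  framing_B X = true ->
  f (diagram_before false (fb1 X)) - f (diagram_after false (fb1 X)) =
  f (diagram_before true (fb2 X)) - f (diagram_after true (fb2 X)).

(* The first clause says that [f] is a function of diagrams up to
   isomorphism. *)
Definition framed_weight_system (V : zmodType)
    (f : framed_chord_diagram -> V) : Prop :=
  (forall D D', diagram_iso D D' -> f D = f D') /\
  (forall X, [/\ four_term_1 f X, four_term_2 f X & four_term_3 f X]).

(* A ribbon graph as a surface glued from discs. A corner is an endpoint of a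
   segment along which an edge-disc meets a vertex-disc. Three kinds of arcs
   join corners in pairs: these segments ([seg]), the free sides of the
   edge-discs ([side]) and the free arcs of the vertex boundaries ([arc]). The
   boundary of an edge-disc is a quadrilateral of two segments and two sides;
   [bare] counts the vertices that meet no edge. *)
Record ribbon_graph := RibbonGraph {
  corner : finType;
  edge : finType;
  edge_of : corner -> edge;
  seg : corner -> corner;
  side : corner -> corner;
  arc : corner -> corner;
  bare : nat;
  segK : involutive seg;
  sideK : involutive side;
  arcK : involutive arc;
  seg_neq : forall x, seg x != x;
  side_neq : forall x, side x != x;
  arc_neq : forall x, arc x != x;
  seg_side_neq : forall x, seg x != side x;
  seg_side_comm : forall x, seg (side x) = side (seg x);
  edge_of_surj : forall e, exists x, edge_of x = e;
  edge_ofP : forall x y,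
    (edge_of x == edge_of y) = (y \in [:: x; seg x; side x; seg (side x)])
}.

(* The boundary of a vertex-disc alternates [seg] and [arc]; a boundary
   component of the surface alternates [side] and [arc]. A bare vertex is
   also a component with one boundary circle. *)
Definition nb_vertices (G : ribbon_graph) : nat :=
  (n_comp (relU (frel (@seg G)) (frel (@arc G))) predT + bare G)%N.

Definition nb_edges (G : ribbon_graph) : nat := #|edge G|.

Definition nb_boundaries (G : ribbon_graph) : nat :=
  (n_comp (relU (frel (@side G)) (frel (@arc G))) predT + bare G)%N.

(* Coherent orientations of all the discs amount to a 2-colouring of the
   corners that alternates along every arc. *)
Definition orientable (G : ribbon_graph) : bool :=
  [exists c : {ffun corner G -> bool}, forall x,
    [&& c (seg x) != c x, c (side x) != c x & c (arc x) != c x]].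

(* For connected [G], capping the boundary components with discs gives a closed
   surface of Euler characteristic chi = V - E + F <= 2, whose genus g satisfies
   chi = 2 - 2g (orientable) or chi = 2 - g (non-orientable). *)
Definition genus (G : ribbon_graph) : nat :=
  let d := (2 + nb_edges G - (nb_vertices G + nb_boundaries G))%N in
  if orientable G then d./2 else d.

Definition euler_genus (G : ribbon_graph) : nat :=
  if orientable G then (2 * genus G)%N else genus G.

(* The vertex-discs of the partial dual are bounded by the boundary components
   of (V(G), A). Such a component runs along the sides of the edges in [A],
   along the segments of the other edges (which are deleted), and along the
   arcs. *)
Section PartialDual.
Variables (G : ribbon_graph) (A : {set edge G}).

Definition pd_seg (x : corner G) : corner G :=
  if edge_of x \in A then side x else seg x.

Definition pd_side (x : corner G) : corner G :=
  if edge_of x \in A then seg x else side x.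

Lemma edge_of_seg (x : corner G) : edge_of (seg x) = edge_of x.
Proof. by apply/esym/eqP; rewrite edge_ofP !inE eqxx orbT. Qed.

Lemma edge_of_side (x : corner G) : edge_of (side x) = edge_of x.
Proof. by apply/esym/eqP; rewrite edge_ofP !inE eqxx !orbT. Qed.

Lemma pd_segK : involutive pd_seg.
Proof.
move=> x; rewrite /pd_seg; case xA: (edge_of x \in A).
  by rewrite edge_of_side xA sideK.
by rewrite edge_of_seg xA segK.
Qed.

Lemma pd_sideK : involutive pd_side.
Proof.
move=> x; rewrite /pd_side; case xA: (edge_of x \in A).
  by rewrite edge_of_seg xA segK.
by rewrite edge_of_side xA sideK.
Qed.

Lemma pd_seg_neq (x : corner G) : pd_seg x != x.
Proof. by rewrite /pd_seg; case: ifP; rewrite ?side_neq ?seg_neq. Qed.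

Lemma pd_side_neq (x : corner G) : pd_side x != x.
Proof. by rewrite /pd_side; case: ifP; rewrite ?side_neq ?seg_neq. Qed.

Lemma pd_seg_side_neq (x : corner G) : pd_seg x != pd_side x.
Proof.
by rewrite /pd_seg /pd_side; case: (_ \in A); rewrite 1?[side x == _]eq_sym seg_side_neq.
Qed.

Lemma pd_seg_side_comm (x : corner G) :
  pd_seg (pd_side x) = pd_side (pd_seg x).
Proof.
rewrite /pd_seg /pd_side; case xA: (edge_of x \in A);
by rewrite ?edge_of_seg ?edge_of_side xA seg_side_comm.
Qed.

Lemma pd_edge_ofP (x y : corner G) :
  (edge_of x == edge_of y) =
  (y \in [:: x; pd_seg x; pd_side x; pd_seg (pd_side x)]).
Proof.
rewrite edge_ofP /pd_seg /pd_side !inE; case xA: (edge_of x \in A);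
rewrite ?edge_of_seg ?edge_of_side xA //.
by rewrite seg_side_comm; do 4?case: (y == _).
Qed.

Definition partial_dual : ribbon_graph :=
  @RibbonGraph (corner G) (edge G) (@edge_of G) pd_seg pd_side (@arc G)
    (bare G) pd_segK pd_sideK (@arcK G) pd_seg_neq pd_side_neq (@arc_neq G)
    pd_seg_side_neq pd_seg_side_comm (@edge_of_surj G) pd_edge_ofP.
End PartialDual.

Definition partial_dual_polynomial (G : ribbon_graph) : {poly int} :=
  \sum_(A : {set edge G}) 'X^(euler_genus (partial_dual A)).

(* The ribbon graph of a diagram. The corners [(p, false)] and [(p, true)] are
   the beginning and the end, along the core circle, of the segment around the
   chord endpoint [p]. An untwisted band joins the end of one segment to the
   beginning of the other; a half-twisted band joins ends to ends and
   beginnings to beginnings. *)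
Section RibbonOfDiagram.
Variable D : framed_chord_diagram.

Definition chord_at (p : core D) : {set core D} := [set p; mate p].

Definition chords : {set {set core D}} := [set chord_at p | p : core D].

Definition dg_edge_of (x : core D * bool) : {c | c \in chords} :=
  exist _ (chord_at x.1) (imset_f chord_at (isT : x.1 \in core D)).

Definition dg_seg (x : core D * bool) : core D * bool := (x.1, ~~ x.2).

Definition dg_side (x : core D * bool) : core D * bool :=
  (mate x.1, if framing x.1 then x.2 else ~~ x.2).

Definition dg_arc (x : core D * bool) : core D * bool :=
  if x.2 then (next x.1, false) else (finv (@next (core D)) x.1, true).

Lemma dg_segK : involutive dg_seg.
Proof. by case=> p b; rewrite /dg_seg /= negbK. Qed.

Lemma dg_sideK : involutive dg_side.
Proof.
by case=> p b; rewrite /dg_side /= framing_mate mateK; case: (framing p);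
  rewrite ?negbK.
Qed.

Lemma dg_arcK : involutive dg_arc.
Proof.
have inj := @next_inj (core D).
by case=> p [] /=; rewrite /dg_arc /= ?finv_f ?f_finv.
Qed.

Lemma dg_seg_neq x : dg_seg x != x.
Proof. by case: x => p []; rewrite /dg_seg xpair_eqE /= andbF. Qed.

Lemma dg_side_neq x : dg_side x != x.
Proof. by case: x => p b; rewrite /dg_side xpair_eqE (negPf (mate_neq p)). Qed.

Lemma dg_arc_neq x : dg_arc x != x.
Proof. by case: x => p []; rewrite /dg_arc xpair_eqE /= andbF. Qed.

Lemma dg_seg_side_neq x : dg_seg x != dg_side x.
Proof.
by case: x => p b; rewrite xpair_eqE /= eq_sym (negPf (mate_neq p)).
Qed.

Lemma dg_seg_side_comm x : dg_seg (dg_side x) = dg_side (dg_seg x).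
Proof. by case: x => p b; rewrite /dg_seg /dg_side /=; case: (framing p). Qed.

Lemma dg_edge_of_surj e : exists x, dg_edge_of x = e.
Proof.
case: e => c cP; case/imsetP: (cP) => p _ cE.
by exists (p, true); apply: val_inj; rewrite /= cE.
Qed.

Lemma dg_edge_ofP x y :
  (dg_edge_of x == dg_edge_of y) =
  (y \in [:: x; dg_seg x; dg_side x; dg_seg (dg_side x)]).
Proof.
case: x y => [p b] [q c].
have -> : (dg_edge_of (p, b) == dg_edge_of (q, c)) = (q == p) || (q == mate p).
  apply/eqP/idP => [/(congr1 val) /= E|].
    by have := set21 q (mate q); rewrite -/(chord_at q) -E !inE.
  case/orP => /eqP ->; apply: val_inj => //=.
  by rewrite /chord_at mateK setUC.
rewrite !inE /dg_seg /dg_side /= !xpair_eqE.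
by case: (q == p); case: (q == mate p); case: (framing p); case: b; case: c.
Qed.

(* When there are no chords the vertex-disc meets no edge. *)
Definition ribbon_of_diagram : ribbon_graph :=
  @RibbonGraph _ _ dg_edge_of dg_seg dg_side dg_arc (#|core D| == 0%N)
    dg_segK dg_sideK dg_arcK dg_seg_neq dg_side_neq dg_arc_neq
    dg_seg_side_neq dg_seg_side_comm dg_edge_of_surj dg_edge_ofP.
End RibbonOfDiagram.

(* Main.v *)
From HB Require Import structures.
From mathcomp Require Import all_boot all_order all_algebra.
Require Import Defs.
Set Implicit Arguments.
Unset Strict Implicit.
Unset Printing Implicit Defensive.
Import GRing.Theory.

(** The Euler genus of a partial dual G^T depends only on the orientability of
G, on the number of edges, and on the numbers F(T) and F(~T) of boundary
circles of the spanning subgraphs (V(G), T) and (V(G), E(G) - T): the boundary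
circles of (V(G), T) bound the vertex-discs of G^T, while capping off G^T uses
those of the complement. The polynomial is therefore a sum over T of terms
that only count boundary circles, and the four-term relation can be proved for
each T separately, according to which of the chords A and B belong to T.

- If T contains both A and B, the band A can slide along the band B in
  (V(G), T) without changing its boundary circles up to homeomorphism: the end
  of A that starts on one side of an end of B arrives at the side of the other
  end of B to which the free edge of B leads. A half-twisted B changes that
  side and adds a half twist to A. The complement of T does not contain A, and
  there the end of A can be anywhere. So the first term on the left is equal
  to the first one on the right, and the second to the second. If T contains
  neither, exchange T and its complement.
- If T contains A but not B, the end of A can be moved past the foot of B in
  (V(G), T), and anywhere in the complement, so both sides of the relation
  vanish. If T contains B but not A, exchange T and its complement.

Boundary circles are the components of a graph whose edges are given by two
involutions on the corners: the bands (along a free edge for a chord of T,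
across its foot otherwise) and the arcs of the core circle. Adding the end of
A splices its two corners into one arc. Sliding A along B and moving A past
the foot of an absent B are the same operation on these graphs: a spliced pair
jumps over an edge of the first involution (lemma [slide]). If A is not in T,
its end only subdivides an arc (lemma [float]).

Orientability does not vary either: partial duality preserves it, it means that
no chord of the diagram is twisted, and a relation in which the framing of A
changes has a twisted B. *)

(** * Counting circles traced by two involutions *)

(** A map that sends edges to connected pairs and meets every component induces
a surjection between the sets of components. The two graphs may have different
vertices, and the map need not be injective: that is what allows a component
to be shortened or lengthened. *)
Lemma n_comp_leq (S T : finType) (e : rel S) (e' : rel T) (phi : S -> T) :
    connect_sym e -> connect_sym e' ->
    (forall x y, e x y -> connect e' (phi x) (phi y)) ->
    (forall z, exists x, connect e' (phi x) z) ->
  n_comp e' predT <= n_comp e predT.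
Proof.
move=> syme syme' homo_phi surj_phi; rewrite /n_comp_mem.
apply: leq_trans _ (leq_image_card (fingraph.root e' \o phi) _).
apply/subset_leq_card/subsetP=> z; rewrite !inE andbT => /eqP rz.
have [x xz] := surj_phi z; apply/imageP; exists (fingraph.root e x).
  by rewrite !inE roots_root.
rewrite -rz; apply/(fingraph.rootP syme'); rewrite syme'.
have homoc u v : connect e u v -> connect e' (phi u) (phi v).
  case/connectP=> p; elim: p u => [u _ -> //|a p IH u /= /andP[ua pa] vE].
  by apply: connect_trans (homo_phi _ _ ua) (IH _ pa vE).
by apply: connect_trans xz; apply: homoc; rewrite syme connect_root.
Qed.

Section Circles.
Variable S : finType.
Implicit Types s t : S -> S.

Definition walk s t : rel S := relU (frel s) (frel t).

Lemma walkE s t x y : walk s t x y = (s x == y) || (t x == y).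
Proof. by []. Qed.

Definition nb_circles s t := n_comp (walk s t) predT.

Lemma walk_sym s t : involutive s -> involutive t -> connect_sym (walk s t).
Proof.
move=> sK tK; apply: sym_connect_sym => x y; rewrite !walkE.
by congr (_ || _); apply/eqP/eqP=> <-.
Qed.

Lemma eq_nb_circles s1 s2 t1 t2 :
  s1 =1 s2 -> t1 =1 t2 -> nb_circles s1 t1 = nb_circles s2 t2.
Proof.
move=> s12 t12; apply: eq_n_comp; apply: eq_connect => x y.
by rewrite !walkE s12 t12.
Qed.

End Circles.

Lemma nb_circles_conj (S T : finType) (h : S -> T) s1 t1 s2 t2 :
    involutive s1 -> involutive t1 -> involutive s2 -> involutive t2 ->
    bijective h -> {morph h : x / s1 x >-> s2 x} ->
    {morph h : x / t1 x >-> t2 x} ->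
  nb_circles s1 t1 = nb_circles s2 t2.
Proof.
move=> s1K t1K s2K t2K [g hK gK] hs ht.
have [sym1 sym2] := (walk_sym s1K t1K, walk_sym s2K t2K).
have gs x : g (s2 x) = s1 (g x) by apply: (can_inj hK); rewrite hs !gK.
have gt x : g (t2 x) = t1 (g x) by apply: (can_inj hK); rewrite ht !gK.
apply/eqP; rewrite eqn_leq; apply/andP; split.
  apply: (@n_comp_leq _ _ _ _ g) => // [x y xy|z].
    apply: connect1; move: xy; rewrite !walkE => /orP[] /eqP <-.
      by rewrite gs eqxx.
    by rewrite gt eqxx orbT.
  by exists (h z); rewrite hK.
apply: (@n_comp_leq _ _ _ _ h) => // [x y xy|z].
  apply: connect1; move: xy; rewrite !walkE => /orP[] /eqP <-.
    by rewrite hs eqxx.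
  by rewrite ht eqxx orbT.
by exists (g z); rewrite gK.
Qed.

(** * Splicing a pair of points into an arc *)

Section Splice.
Variables (S : finType) (t : S -> S).
Hypotheses (tK : involutive t) (t_neq : forall x, t x != x).

(** The involution [t'] is obtained from [t], for which [n] and [n'] form a
separate arc, by cutting the arc at [w] and inserting this pair, [n] on the
side of [w]. *)
Record spliced (t' : S -> S) (w n n' : S) : Prop := Spliced {
  spliceK : involutive t';
  splice_loop : t n = n';
  splice_out : (w != n) && (w != n');
  splice_start : t' w = n;
  splice_end : t' (t w) = n';
  splice_id : forall x, x \notin [:: w; t w; n; n'] -> t' x = t x
}.

(** This reduces a verification over all arcs of [t'] to the two new arcs and
the untouched ones, each in a single direction. *)
Lemma splice_sym_ind t' w n n' (P : S -> S -> Prop) :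
    spliced t' w n n' -> (forall x y, P x y -> P y x) ->
    P w n -> P (t w) n' ->
    (forall x, x \notin [:: w; t w; n; n'] -> P x (t x)) ->
  forall x, P x (t' x).
Proof.
case=> t'K tn _ t'w t'tw t'id symP Pw Ptw Pid x.
have [|xN] := boolP (x \in [:: w; t w; n; n']); last first.
  by rewrite t'id //; apply: Pid.
rewrite !inE => /or4P[] /eqP ->.
- by rewrite t'w.
- by rewrite t'tw.
- by rewrite -t'w t'K; apply: symP; rewrite t'w.
by rewrite -t'tw t'K; apply: symP; rewrite t'tw.
Qed.

Variable s : S -> S.
Hypotheses (sK : involutive s).

Lemma walk_l t' x : connect (walk s t') x (s x).
Proof. by apply: connect1; rewrite walkE eqxx. Qed.

Lemma walk_r t' x : connect (walk s t') x (t' x).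
Proof. by apply: connect1; rewrite walkE eqxx orbT. Qed.

(** The first graph contains n - w = u - t u and n' - t w, the second one
n' - u = w - t w and n - t u, where = is the edge that [s] puts between [w]
and [u]. In both, this edge is a detour, from [n] to [t u] or from [n'] to
[t w]; without the detour the two graphs agree, because the roles of [n] and
[n'] are exchanged. The map that contracts the detour to [n] turns walks of the
first graph into walks of the second. *)
Lemma slide_leq t1 t2 w u n n' :
    spliced t1 w n n' -> spliced t2 u n' n -> s w = u -> u != w ->
  nb_circles s t2 <= nb_circles s t1.
Proof.
move=> sp1 sp2 sw uw.
have [t1K _ /andP[wn wn'] _ _ _] := sp1.
have [t2K _ /andP[un' un] t2u t2tu t2id] := sp2.
have su : s u = w by rewrite -sw sK.
have [sym1 sym2] := (walk_sym sK t1K, walk_sym sK t2K).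
have cs x : connect (walk s t2) x (s x) by exact: walk_l.
have ct x : connect (walk s t2) x (t2 x) by exact: walk_r.
pose phi x := if x \in [:: w; u] then n else x.
have phi_id x : x != w -> x != u -> phi x = x.
  by rewrite /phi !inE => /negPf-> /negPf->.
have phiw : phi w = n by rewrite /phi !inE eqxx.
have phiu : phi u = n by rewrite /phi !inE eqxx orbT.
have phin : phi n = n by rewrite phi_id // eq_sym.
have phin' : phi n' = n' by rewrite phi_id // eq_sym.
have un'c : connect (walk s t2) u n' by rewrite -t2u.
have wn'c : connect (walk s t2) w n' by apply: connect_trans un'c; rewrite -sw.
have tun : connect (walk s t2) (t u) n by rewrite -t2tu.
have step_t x : connect (walk s t2) (phi x) (phi (t1 x)).
  pose P x y := connect (walk s t2) (phi x) (phi y).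
  move: x; apply: (splice_sym_ind (P := P) sp1) => [x y|||x]; rewrite /P.
  - by rewrite sym2.
  - by rewrite phiw phin.
  (* When w and u are the two ends of one arc, cutting it at w also cuts it at
     u. *)
  - have [twu|twu] := eqVneq (t w) u.
      rewrite twu phiu phin' sym2; apply: connect_trans tun.
      by rewrite -twu tK sym2.
    rewrite phin' phi_id ?t_neq //; apply: connect_trans wn'c.
    rewrite sym2 -t2id // !inE !negb_or [w == u]eq_sym uw wn wn' /= !andbT.
    by apply: contra twu => /eqP->; rewrite tK.
  rewrite !inE !negb_or => /and4P[xw xtw xn xn'].
  have txw : t x != w by apply: contra xtw => /eqP<-; rewrite tK.
  have [->|xu] := eqVneq x u.
    have [->|tuw] := eqVneq (t u) w; first by rewrite phiu phiw.
    by rewrite phiu phi_id ?t_neq // sym2.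
  have [txu|txu] := eqVneq (t x) u.
    by rewrite txu phiu phi_id // -[x]tK txu.
  rewrite !phi_id // -t2id // !inE !negb_or xu xn xn' /= ?andbT.
  by apply: contra txu => /eqP->; rewrite tK.
apply: (@n_comp_leq _ _ _ _ phi) => // [x y /orP[] /eqP <- //|z].
  have [->|xw] := eqVneq x w; first by rewrite sw phiw phiu.
  have [->|xu] := eqVneq x u; first by rewrite su phiw phiu.
  rewrite !phi_id //; first by apply: contra xu => /eqP E; rewrite -[x]sK E sw.
  by apply: contra xw => /eqP E; rewrite -[x]sK E su.
have [->|zw] := eqVneq z w; first by exists n'; rewrite phin' sym2.
have [->|zu] := eqVneq z u; first by exists n'; rewrite phin' sym2.
by exists z; rewrite phi_id.
Qed.

(** If [s] joins [n] to [n'], the spliced pair only subdivides an arc, and the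
map that contracts it to [w] shows that its place does not matter. *)
Lemma float_leq t1 t2 w w' n n' m m' :
    spliced t1 w n n' -> spliced t2 w' m m' -> m \in [:: n; n'] ->
    s n = n' ->
  nb_circles s t2 <= nb_circles s t1.
Proof.
move=> sp1 sp2 mn sn.
have [t1K tn /andP[wn wn'] _ _ _] := sp1.
have [t2K tm /andP[wm wm'] t2w t2tw t2id] := sp2.
have sn' : s n' = n by rewrite -sn sK.
have sm : s m = m'.
  move: mn; rewrite -tm !inE => /orP[] /eqP->; first by rewrite sn tn.
  by rewrite sn' -tn tK.
have mm'E x : (x \in [:: m; m']) = (x \in [:: n; n']).
  move: mn; rewrite -tm !inE => /orP[] /eqP->; first by rewrite tn.
  by rewrite -tn tK orbC.
have [sym1 sym2] := (walk_sym sK t1K, walk_sym sK t2K).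
have cs x : connect (walk s t2) x (s x) by exact: walk_l.
have ct x : connect (walk s t2) x (t2 x) by exact: walk_r.
have twm : connect (walk s t2) (t w') m'.
  by rewrite -t2tw.
have wmc : connect (walk s t2) w' m by rewrite -t2w.
have wm'c : connect (walk s t2) w' m'.
  by apply: connect_trans wmc _; rewrite -sm.
have wtw : connect (walk s t2) w' (t w').
  by apply: connect_trans wm'c _; rewrite sym2.
have ctt x : x \notin [:: n; n'] -> connect (walk s t2) x (t x).
  rewrite -mm'E => xmm.
  have [->|xw] := eqVneq x w'; first by [].
  have [->|xtw] := eqVneq x (t w'); first by rewrite tK sym2.
  by rewrite -t2id // !inE !negb_or xw xtw; move: xmm; rewrite !inE negb_or.
pose phi x := if x \in [:: n; n'] then w else x.
have phi_id x : x \notin [:: n; n'] -> phi x = x by rewrite /phi => /negPf->.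
have phin : phi n = w by rewrite /phi !inE eqxx.
have phin' : phi n' = w by rewrite /phi !inE eqxx orbT.
have wN : w \notin [:: n; n'] by rewrite !inE negb_or wn.
have tN x : (t x \in [:: n; n']) = (x \in [:: n; n']).
  rewrite !inE orbC -{1}tn (can_eq tK); congr (_ || _).
  by rewrite -(can_eq tK) tn tK.
have sN x : (s x \in [:: n; n']) = (x \in [:: n; n']).
  by rewrite !inE orbC -{1}sn -{2}sn' !(can_eq sK).
apply: (@n_comp_leq _ _ _ _ phi) => // [x y /orP[] /eqP <-|z].
- have [xN|xN] := boolP (x \in [:: n; n']).
    by rewrite /phi sN xN.
  by rewrite !phi_id ?sN.
- pose P x y := connect (walk s t2) (phi x) (phi y).
  move: x {y}; apply: (splice_sym_ind (P := P) sp1) => [x y|||x]; rewrite /P.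
  + by rewrite sym2.
  + by rewrite phin phi_id.
  + by rewrite phin' phi_id ?tN // sym2 ctt.
  rewrite !inE !negb_or => /and4P[_ _ xn xn'].
  have xN : x \notin [:: n; n'] by rewrite !inE negb_or xn.
  by rewrite !phi_id ?tN // ctt.
have [|zN] := boolP (z \in [:: n; n']); last by exists z; rewrite phi_id.
have w'N : w' \notin [:: n; n'] by rewrite -mm'E !inE negb_or wm.
rewrite -mm'E !inE => /orP[] /eqP ->; exists w'; rewrite phi_id //.
Qed.

Lemma slide t1 t2 w u n n' :
    spliced t1 w n n' -> spliced t2 u n' n -> s w = u -> u != w ->
  nb_circles s t1 = nb_circles s t2.
Proof.
move=> sp1 sp2 sw uw; apply/eqP.
rewrite eqn_leq (slide_leq sp1 sp2) // (slide_leq sp2 sp1) //.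
  by rewrite -sw sK.
by rewrite eq_sym.
Qed.

Lemma float t1 t2 w w' n n' m m' :
    spliced t1 w n n' -> spliced t2 w' m m' -> m \in [:: n; n'] ->
    s n = n' ->
  nb_circles s t1 = nb_circles s t2.
Proof.
move=> sp1 sp2 mn sn; apply/eqP.
rewrite eqn_leq (float_leq sp1 sp2 mn sn) andbT.
have [[_ tn _ _ _ _] [_ tm _ _ _ _]] := (sp1, sp2).
have sn' : s n' = n by rewrite -sn sK.
have tn' : t n' = n by rewrite -tn tK.
move: mn; rewrite !inE => /orP[] /eqP mE; subst m; apply: (float_leq sp2 sp1).
- by rewrite !inE eqxx.
- by rewrite sn -tn.
- by rewrite -tm tn' !inE eqxx orbT.
- by rewrite sn' -tm.
Qed.

End Splice.

(** * Partial duals up to isomorphism *)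

Section Invariance.
Implicit Types G : ribbon_graph.

Lemma eq_euler_genus G G' :
    orientable G = orientable G' -> nb_edges G = nb_edges G' ->
    nb_vertices G = nb_vertices G' -> nb_boundaries G = nb_boundaries G' ->
  euler_genus G = euler_genus G'.
Proof. by rewrite /euler_genus /genus => -> -> -> ->. Qed.

(** A partial dual only exchanges the roles of segments and sides, and a
2-colouring has to alternate along both. *)
Lemma orientable_partial_dual G (A : {set edge G}) :
  orientable (partial_dual A) = orientable G.
Proof.
apply: eq_existsb => c; apply: eq_forallb => x /=.
by rewrite /pd_seg /pd_side; case: ifP => // _; rewrite andbCA.
Qed.

Lemma pd_side_setC G (A : {set edge G}) : @pd_side G A =1 @pd_seg G (~: A).
Proof. by move=> x; rewrite /pd_side /pd_seg inE if_neg. Qed.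

Lemma nb_vertices_partial_dual G (A : {set edge G}) :
  nb_vertices (partial_dual A) = nb_circles (@pd_seg G A) (@arc G) + bare G.
Proof. by []. Qed.

Lemma nb_boundaries_partial_dual G (A : {set edge G}) :
  nb_boundaries (partial_dual A) =
  nb_circles (@pd_seg G (~: A)) (@arc G) + bare G.
Proof.
by rewrite -(eq_nb_circles (@pd_side_setC G A) (frefl _)).
Qed.

Lemma edge_map G G' (h : corner G -> corner G') :
    {morph h : x / seg x} -> {morph h : x / side x} ->
  exists f : edge G -> edge G', forall x, f (edge_of x) = edge_of (h x).
Proof.
move=> h_seg h_side.
have inv e : exists x, edge_of x == e :> edge G.
  by have [x <-] := edge_of_surj e; exists x.
exists (fun e => edge_of (h (xchoose (inv e)))) => x.
have := xchooseP (inv (edge_of x)); move: (xchoose _) => x0.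
rewrite edge_ofP => xx0; apply/eqP.
by rewrite edge_ofP -h_seg -h_side -h_seg; apply: (map_f h xx0).
Qed.

Lemma partial_dual_polynomial_iso G G' (h : corner G -> corner G') :
    bijective h -> {morph h : x / seg x} -> {morph h : x / side x} ->
    {morph h : x / arc x} -> bare G = bare G' ->
  partial_dual_polynomial G = partial_dual_polynomial G'.
Proof.
case=> g hK gK hseg hside harc bareE.
have gseg : {morph g : x / seg x}.
  by move=> x; apply: (can_inj hK); rewrite hseg !gK.
have gside : {morph g : x / side x}.
  by move=> x; apply: (can_inj hK); rewrite hside !gK.
have [f fE] := edge_map hseg hside; have [f' f'E] := edge_map gseg gside.
have fK : cancel f f'.
  by move=> e; have [x <-] := edge_of_surj e; rewrite fE f'E hK.
have f'K : cancel f' f.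
  by move=> e; have [x <-] := edge_of_surj e; rewrite f'E fE gK.
have h_bij : bijective h by exists g.
have orE : orientable G = orientable G'.
  apply/existsP/existsP=> -[c /forallP cP].
    exists [ffun x => c (g x)]; apply/forallP => x; rewrite !ffunE.
    rewrite gseg gside; suff -> : g (arc x) = arc (g x) by [].
    by apply: (can_inj hK); rewrite harc !gK.
  exists [ffun x => c (h x)]; apply/forallP => x; rewrite !ffunE.
  by rewrite hseg hside harc.
have circE (A : {set edge G'}) :
    nb_circles (@pd_seg G (f @^-1: A)) (@arc G) =
    nb_circles (@pd_seg G' A) (@arc G').
  apply: (nb_circles_conj (h := h)) => //; try exact: pd_segK; try exact: arcK.
  move=> x; rewrite /pd_seg inE fE.
  by case: ifP; rewrite ?hseg ?hside.
rewrite /partial_dual_polynomial.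
rewrite (reindex (fun A : {set edge G'} => f @^-1: A)) /=.
  apply: eq_bigr => A _; congr ('X^_)%R.
  apply: eq_euler_genus; rewrite ?orientable_partial_dual //.
  - by apply: (bij_eq_card (f := f)); exists f'.
  - by rewrite !nb_vertices_partial_dual circE bareE.
  by rewrite !nb_boundaries_partial_dual bareE -preimsetC circE.
exists (fun A : {set edge G} => f' @^-1: A) => A _;
  by apply/setP=> e; rewrite !inE ?fK ?f'K.
Qed.

Lemma partial_dual_polynomial_diagram_iso D D' :
    diagram_iso D D' ->
  partial_dual_polynomial (ribbon_of_diagram D) =
  partial_dual_polynomial (ribbon_of_diagram D').
Proof.
case=> h [h_bij h_next h_mate h_framing].
have [g hK gK] := h_bij.
pose hc (x : corner (ribbon_of_diagram D)) : corner (ribbon_of_diagram D') :=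
  (h x.1, x.2).
apply: (@partial_dual_polynomial_iso _ _ hc).
- by exists (fun x => (g x.1, x.2)) => -[p b]; rewrite /hc /= ?hK ?gK.
- by [].
- by case=> p b; rewrite /hc /= /dg_side /= h_mate h_framing.
- case=> p [] /=; rewrite /hc /dg_arc /= ?h_next //; congr (_, _).
  apply: (@next_inj (core D')).
  by rewrite -h_next !f_finv //; apply: next_inj.
by rewrite /= (bij_eq_card h_bij).
Qed.

End Invariance.

(** The colouring alternates along the core circle, hence is the same at the
beginnings of all segments, so a twisted band would join two corners of the
same colour. *)
Lemma orientable_ribbon_of_diagram D :
  orientable (ribbon_of_diagram D) = [forall p : core D, ~~ framing p].
Proof.
apply/existsP/forallP=> [[c /forallP cP] p|untwisted].
  have cflip x : c (dg_seg x) = ~~ c x.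
    by have /and3P[+ _ _] := cP x; rewrite /=; do 2!case: (c _).
  have carc x : c (dg_arc x) = ~~ c x.
    by have /and3P[_ _ +] := cP x; rewrite /=; do 2!case: (c _).
  have cconst q r : c (q, false) = c (r, false).
    have /connectP[s + ->] := next_cyclic q r.
    elim: s q => [|q' s IH] q //= /andP[/eqP <- /IH <-].
    by rewrite -[(next q, _)]/(dg_arc (q, true)) carc -cflip.
  have /and3P[_ + _] := cP (p, false); rewrite /= /dg_side /=.
  by case: (framing p) => //; rewrite (cconst p (mate p)) eqxx.
exists [ffun x : core D * bool => x.2]; apply/forallP=> -[p b].
rewrite !ffunE /= /dg_side /dg_arc /= (negPf (untwisted p)).
by case: b.
Qed.

(** * A new point on a circle *)

Section CircleArc.
Variable C : circle.

Definition circle_arc (x : C * bool) : C * bool :=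
  if x.2 then (next x.1, false) else (finv (@next C) x.1, true).

Lemma circle_arcK : involutive circle_arc.
Proof.
have inj := @next_inj C.
by case=> p []; rewrite /circle_arc /= ?finv_f ?f_finv.
Qed.

(** The arcs of the circle, with the two corners of the future point [None]
joined to each other. *)
Definition base_arc (x : option C * bool) : option C * bool :=
  if x.1 is Some p then
    (Some (circle_arc (p, x.2)).1, (circle_arc (p, x.2)).2)
  else (None, ~~ x.2).

Lemma base_arcK : involutive base_arc.
Proof.
case=> [[p|] b]; rewrite /base_arc /= ?negbK //.
by rewrite -surjective_pairing circle_arcK.
Qed.

Lemma base_arc_neq x : base_arc x != x.
Proof. by case: x => [[p|] []]; rewrite xpair_eqE ?andbF. Qed.

(** A corner [(p, b)] stands for the place next to [p], after it if [b] holds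
and before it otherwise. *)
Definition next_at (w : C * bool) : option C -> option C :=
  if w.2 then next_after w.1 else next_before w.1.

Definition next_at_cyclic (w : C * bool) :
    forall o o', fconnect (next_at w) o o' :=
  match w.2 as c return
    forall o o', fconnect (if c then next_after w.1 else next_before w.1) o o'
  with
  | true => next_after_cyclic w.1
  | false => next_before_cyclic w.1
  end.

Definition insert_at (w : C * bool) : circle :=
  @Circle (option C) (next_at w) (next_at_cyclic w).

End CircleArc.

(** The new point faces its neighbour with its opposite corner: its
beginning meets the end of a point that it follows. *)
Lemma insert_at_spliced (C : circle) (w : C * bool) :
  spliced (@base_arc C) (@circle_arc (insert_at w))
    (Some w.1, w.2) (None, ~~ w.2) (None, w.2).
Proof.
have t'K := @circle_arcK (insert_at w).
have fwd o : circle_arc (C := insert_at w) (o, true) = (next_at w o, false).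
  by [].
split=> //.
- by rewrite /base_arc /= negbK.
- case: w t'K fwd => b [] t'K fwd.
    by rewrite fwd /next_at /= eqxx.
  by rewrite -[RHS]t'K fwd.
- case: w t'K fwd => b [] t'K fwd; rewrite /base_arc /=.
    by rewrite -[RHS]t'K fwd.
  by rewrite fwd /next_at /= f_finv ?eqxx //; apply: next_inj.
have id_fwd p : (Some p, true) \notin
      [:: (Some w.1, w.2); base_arc (Some w.1, w.2); (None, ~~ w.2);
          (None, w.2)] ->
    circle_arc (C := insert_at w) (Some p, true) = base_arc (Some p, true).
  rewrite fwd /next_at /base_arc /circle_arc; case: w {t'K fwd} => b [] /= pN.
    have /negPf -> // : p != b.
    by apply: contra pN => /eqP ->; rewrite inE eqxx.
  case: eqP => // E; case/negP: pN.
  by rewrite -E finv_f ?inE ?eqxx ?orbT //; apply: next_inj.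
case=> [[p|] b] xN.
- case: b xN => xN; first exact: id_fwd.
  have xE : base_arc (Some p, false) = (Some (finv (@next C) p), true) by [].
  apply: (can_inj t'K); rewrite t'K xE id_fwd -xE ?base_arcK //.
  apply: contra xN; rewrite !inE !(can2_eq (@base_arcK C) (@base_arcK C)).
  have nE c : @base_arc C (None, c) = (None, ~~ c) by [].
  rewrite base_arcK !nE negbK.
  by case/or4P=> ->; rewrite ?orbT.
by case/negP: xN; rewrite !inE !xpair_eqE /=; case: b; case: w.2.
Qed.

(** * The diagrams of a four-term relation *)

Section FourTerm.
Variable X : four_term_data.
Notation C := (fcore X).

Definition diagram_at (s : bool) (w : C * bool) : framed_chord_diagram :=
  @FramedChordDiagram (insert_at w) (@add_mate X) (@add_framing X s)
    (@add_mateK X) (@add_mate_neq X) (@add_framing_mate X s).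

Notation P s w :=
  (partial_dual_polynomial (ribbon_of_diagram (diagram_at s w))).

(** The chords are sets of endpoints, which depend neither on the framing of A
nor on its place: the sums over sets of chords have a common index type. *)
Let chord_type := edge (ribbon_of_diagram (diagram_at false (fb1 X, false))).

Implicit Types (s c : bool) (w : C * bool) (T : {set chord_type}).

Definition chord_of (x : option C * bool) : chord_type :=
  @dg_edge_of (diagram_at false (fb1 X, false)) x.

Definition side_at (s : bool) (x : option C * bool) : option C * bool :=
  (add_mate x.1, if add_framing s x.1 then x.2 else ~~ x.2).

Definition band (s : bool) (T : {set chord_type}) (x : option C * bool) :
    option C * bool :=
  if chord_of x \in T then side_at s x else (x.1, ~~ x.2).

Definition circles_at (s : bool) (w : C * bool) (T : {set chord_type}) : nat :=
  nb_circles (band s T) (@circle_arc (insert_at w)).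

Definition euler_genus_at (s : bool) (w : C * bool) (T : {set chord_type}) :
    nat :=
  euler_genus (@partial_dual (ribbon_of_diagram (diagram_at s w)) T).

Lemma polynomial_at s w :
  P s w = (\sum_(T : {set chord_type}) 'X^(euler_genus_at s w T))%R.
Proof. by []. Qed.

Lemma bandK s T : involutive (band s T).
Proof. exact: (@pd_segK (ribbon_of_diagram (diagram_at s (fb1 X, false)))). Qed.

Lemma bare_at s w : bare (ribbon_of_diagram (diagram_at s w)) = 0.
Proof. by rewrite /= card_option. Qed.

Lemma nb_vertices_at s w T :
  nb_vertices (@partial_dual (ribbon_of_diagram (diagram_at s w)) T) =
  circles_at s w T.
Proof. by rewrite nb_vertices_partial_dual bare_at addn0. Qed.

Lemma nb_boundaries_at s w T :
  nb_boundaries (@partial_dual (ribbon_of_diagram (diagram_at s w)) T) =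
  circles_at s w (~: T).
Proof. by rewrite nb_boundaries_partial_dual bare_at addn0. Qed.

Lemma orientable_at s w :
  orientable (ribbon_of_diagram (diagram_at s w)) =
  [forall o, ~~ add_framing (X := X) s o].
Proof. exact: orientable_ribbon_of_diagram. Qed.

Lemma euler_genus_atE s w T :
  let d := (2 + #|chord_type| - (circles_at s w T + circles_at s w (~: T)))%N in
  euler_genus_at s w T =
  if [forall o, ~~ add_framing (X := X) s o] then (2 * d./2)%N else d.
Proof.
move=> d; rewrite /euler_genus_at /euler_genus /genus.
rewrite orientable_partial_dual orientable_at nb_vertices_at nb_boundaries_at.
by rewrite -[nb_edges _]/#|chord_type| -/d; case: ifP => ->.
Qed.

Lemma eq_euler_genus_at s w s' w' T :
    [forall o, ~~ add_framing (X := X) s o] =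
      [forall o, ~~ add_framing (X := X) s' o] ->
    circles_at s w T = circles_at s' w' T ->
    circles_at s w (~: T) = circles_at s' w' (~: T) ->
  euler_genus_at s w T = euler_genus_at s' w' T.
Proof.
by move=> fr_eq eqT eqTC; rewrite !euler_genus_atE fr_eq eqT eqTC.
Qed.

Lemma chord_of_bool o c c' : chord_of (o, c) = chord_of (o, c').
Proof. by apply: val_inj. Qed.

Lemma chord_of_mate o c c' : chord_of (add_mate o, c) = chord_of (o, c').
Proof.
rewrite (chord_of_bool o c' false) (chord_of_bool _ c (~~ add_framing false o)).
exact: (@edge_of_side (ribbon_of_diagram (diagram_at false (fb1 X, false)))
  (o, false)).
Qed.

Lemma band_notin s T o c : chord_of (o, false) \notin T ->
  band s T (o, c) = (o, ~~ c).
Proof. by rewrite /band (chord_of_bool o c false) => /negPf->. Qed.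

Lemma band_in s T o c : chord_of (o, false) \in T ->
  band s T (o, c) = (add_mate o, if add_framing s o then c else ~~ c).
Proof. by rewrite /band (chord_of_bool o c false) => ->. Qed.

Lemma chord_of_y T : (chord_of (Some (fy X), false) \in T) =
  (chord_of (None, false) \in T).
Proof. by rewrite -(chord_of_mate None false). Qed.

(** * Moving an end of A *)

Lemma floating_end s s' w w' T : chord_of (None, false) \notin T ->
  circles_at s w T = circles_at s' w' T.
Proof.
move=> AT.
have bandss' : band s T =1 band s' T.
  case=> o c; have [oT|oT] := boolP (chord_of (o, false) \in T); last first.
    by rewrite !band_notin.
  rewrite !band_in //; case: o oT => [p|] oT; last by rewrite oT in AT.
  have py : p != fy X by apply: contra AT => /eqP yE; rewrite -chord_of_y -yE.
  by rewrite /= (negPf py).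
rewrite /circles_at (eq_nb_circles bandss' (frefl _)).
have := float (@base_arcK C) (bandK s' T) (insert_at_spliced w)
  (insert_at_spliced w').
apply; last by rewrite band_notin ?negbK.
by rewrite !inE !xpair_eqE eqxx /=; case: w.2; case: w'.2.
Qed.

(** Without the band B, a boundary circle runs across the foot of B, and the
end of A moves along with it. *)
Lemma slide_absent s b c T : chord_of (Some b, false) \notin T ->
  circles_at s (b, c) T = circles_at s (b, ~~ c) T.
Proof.
move=> bT; have sp' := insert_at_spliced (b, ~~ c); rewrite /= negbK in sp'.
apply: (slide (@base_arcK C) (@base_arc_neq C) (bandK s T)
  (insert_at_spliced (b, c)) sp'); first by rewrite band_notin.
by rewrite xpair_eqE eqxx; case: c {sp'}.
Qed.

(** An untwisted band joins beginnings to ends, so that the end of A reaches the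
other side of its new neighbour, with its two corners in the order that [slide]
produces. *)
Lemma slide_untwisted s b c T : b != fy X -> fframing b = false ->
    chord_of (Some b, false) \in T ->
  circles_at s (b, c) T = circles_at s (fmate b, ~~ c) T.
Proof.
move=> b_y b_fr bT.
have sp' := insert_at_spliced (fmate b, ~~ c); rewrite /= negbK in sp'.
apply: (slide (@base_arcK C) (@base_arc_neq C) (bandK s T)
  (insert_at_spliced (b, c)) sp').
  by rewrite band_in //= (negPf b_y) b_fr.
by rewrite xpair_eqE (inj_eq Some_inj) fmate_fix (negPf b_y).
Qed.

(** Turning over the end of A; this absorbs a half twist of A. *)
Definition flip_end (x : option C * bool) : option C * bool :=
  if x.1 is None then (None, ~~ x.2) else x.

Lemma flip_endK : involutive flip_end.
Proof. by case=> [[p|] b] //=; rewrite /flip_end /= negbK. Qed.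

Lemma band_flip s T : chord_of (None, false) \in T ->
  {morph flip_end : x / band (~~ s) T x >-> band s T x}.
Proof.
move=> AT [o c]; have [oT|oT] := boolP (chord_of (o, false) \in T); last first.
  rewrite band_notin //.
  by case: o oT => [p|] oT; rewrite /flip_end /= band_notin.
case: o oT => [p|] oT; rewrite /flip_end /= !band_in //=; last first.
  by case: s => //=; rewrite negbK.
by have [//|py] := eqVneq p (fy X); case: s; rewrite //= negbK.
Qed.

Lemma flip_spliced t' (p : C) c d (n' : option C * bool) :
    spliced (@base_arc C) t' (Some p, c) (None, d) n' ->
  spliced (@base_arc C) (flip_end \o t' \o flip_end) (Some p, c) n' (None, d).
Proof.
have base_flip x : base_arc (flip_end x) = flip_end (base_arc x).
  by case: x => [[q|] b].
case=> t'K tn out t'w t'tw t'id.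
have n'E : n' = flip_end (None, d) by rewrite -tn.
split.
- by move=> x /=; rewrite flip_endK t'K flip_endK.
- by rewrite -tn base_arcK.
- by rewrite andbC.
- by rewrite /= t'w n'E.
- have fixed : flip_end (base_arc (Some p, c)) = base_arc (Some p, c) by [].
  by rewrite [LHS]/= fixed t'tw n'E flip_endK.
move=> x xN /=; rewrite t'id ?base_flip ?flip_endK //.
apply: contra xN; rewrite !inE !(can2_eq flip_endK flip_endK).
rewrite -base_flip n'E flip_endK.
by case/or4P=> ->; rewrite ?orbT.
Qed.

(** A half-twisted band joins beginnings to beginnings and ends to ends, so that
the end of A arrives reversed. Turning it back changes the framing of A. *)
Lemma slide_twisted s b c T : b != fy X -> fframing b ->
    chord_of (Some b, false) \in T -> chord_of (None, false) \in T ->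
  circles_at s (b, c) T = circles_at (~~ s) (fmate b, c) T.
Proof.
move=> b_y b_fr bT AT.
have sp' := flip_spliced (insert_at_spliced (fmate b, c)).
rewrite /circles_at.
rewrite (slide (@base_arcK C) (@base_arc_neq C) (bandK s T)
  (insert_at_spliced (b, c)) sp').
- apply/esym/(nb_circles_conj (h := flip_end)).
  + exact: bandK.
  + exact: (@circle_arcK (insert_at (fmate b, c))).
  + exact: bandK.
  + exact: spliceK sp'.
  + by exists flip_end; apply: flip_endK.
  + exact: band_flip.
  by move=> x /=; rewrite flip_endK.
- by rewrite band_in //= (negPf b_y) b_fr.
by rewrite xpair_eqE (inj_eq Some_inj) fmate_fix (negPf b_y).
Qed.

(** * The relation, one set of chords at a time *)

(** If the band A is absent its end floats; otherwise B is present as well, and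
A slides along it. *)
Lemma circles_across s c T :
    (chord_of (None, false) \in T -> chord_of (Some (fb1 X), false) \in T) ->
  circles_at s (fb1 X, c) T =
  circles_at (s (+) framing_B X) (fb2 X, framing_B X (+) ~~ c) T.
Proof.
have [AT /(_ isT) BT|AT _] := boolP (chord_of (None, false) \in T); last first.
  exact: floating_end.
rewrite /framing_B; case fr: (fframing _).
  by rewrite addbT /= negbK; apply: slide_twisted; rewrite ?fb1_neq ?fr.
by rewrite addbF /=; apply: slide_untwisted; rewrite ?fb1_neq ?fr.
Qed.

Lemma circles_around s b c T :
    (chord_of (None, false) \in T -> chord_of (Some b, false) \notin T) ->
  circles_at s (b, c) T = circles_at s (b, ~~ c) T.
Proof.
have [AT /(_ isT) bT|AT _] := boolP (chord_of (None, false) \in T).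
  exact: slide_absent.
exact: floating_end.
Qed.

Lemma chord_of_b2 :
  chord_of (Some (fb2 X), false) = chord_of (Some (fb1 X), false).
Proof.
rewrite -(chord_of_mate (Some (fb1 X)) false) /=.
by rewrite (negPf (fb1_neq X)).
Qed.

(** The framing of A changes only if B is twisted, in which case neither diagram
is orientable. *)
Lemma eq_all_untwisted s :
  [forall o, ~~ add_framing (X := X) s o] =
  [forall o, ~~ add_framing (X := X) (s (+) framing_B X) o].
Proof.
rewrite /framing_B; case fr: (fframing _); last by rewrite addbF.
suff twisted s' : [forall o, ~~ add_framing (X := X) s' o] = false.
  by rewrite !twisted.
apply/forallP=> /(_ (Some (fb1 X))).
by rewrite /= (negPf (fb1_neq X)) fr.
Qed.

(** The three relations at once: a twisted B changes the framing of A and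
exchanges the two sides of its end [fb2 X]. *)
Lemma four_term_at s :
  (P s (fb1 X, false) - P s (fb1 X, true) =
   P (s (+) framing_B X) (fb2 X, ~~ framing_B X) -
   P (s (+) framing_B X) (fb2 X, framing_B X))%R.
Proof.
rewrite (polynomial_at s (fb1 X, false)) (polynomial_at s (fb1 X, true)).
rewrite (polynomial_at _ (fb2 X, _)) (polynomial_at _ (fb2 X, framing_B X)).
rewrite -[LHS]sumrB -[RHS]sumrB.
apply: eq_bigr => T _.
have [AB|AB] := eqVneq (chord_of (None, false) \in T)
                       (chord_of (Some (fb1 X), false) \in T).
  (* A and B are both in T or both in its complement. *)
  have across c : euler_genus_at s (fb1 X, c) T =
      euler_genus_at (s (+) framing_B X) (fb2 X, framing_B X (+) ~~ c) T.
    by apply: (eq_euler_genus_at (eq_all_untwisted s)); apply: circles_across;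
      rewrite ?inE AB.
  by rewrite !across addbT addbF.
(* Exactly one of A and B is in T, and the same holds for its complement. *)
have around s' b c : b \in [:: fb1 X; fb2 X] ->
    euler_genus_at s' (b, c) T = euler_genus_at s' (b, ~~ c) T.
  move=> b12.
  have bE : chord_of (Some b, false) = chord_of (Some (fb1 X), false).
    by move: b12; rewrite !inE => /orP[] /eqP->; rewrite ?chord_of_b2.
  by apply: (eq_euler_genus_at erefl); apply: circles_around; rewrite bE ?inE;
    move: AB; do 2!case: (_ \in T).
have e1 : euler_genus_at s (fb1 X, true) T = euler_genus_at s (fb1 X, false) T.
  exact: around (mem_head _ _).
have e2 := around (s (+) framing_B X) _ (framing_B X) (mem_last _ [:: fb2 X]).
rewrite e1 -e2.
exact: etrans (subrr _) (esym (subrr _)).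
Qed.

End FourTerm.

Theorem theorem4p2 :
  framed_weight_system
    (fun D : framed_chord_diagram =>
       partial_dual_polynomial (ribbon_of_diagram D)).
Proof.
split=> [D D'|X]; first exact: partial_dual_polynomial_diagram_iso.
split=> fr.
- by have := four_term_at X false; rewrite fr.
- by have := four_term_at X true; rewrite fr.
by have := four_term_at X false; rewrite fr.
Qed.
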